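(* Let $\mathbb F$ be a field, let $n\ge 0$, $d\ge 1$ and $D$ be integers, and let $Z=\{z_{1,0},\dots,z_{1,d}\}\times\dots\times\{z_{n,0},\dots,z_{n,d}\}$ be a grid with $z_{i,j}\neq z_{i,j'}$ for all $i\in[n]$ and $j\neq j'$. Let $\alpha_\ell\in\mathbb F$ be given for all $\ell\in\binom{[n]}{\le D}_d$. Then there is a unique $n$-variate polynomial $P$ over $\mathbb F$ with individual degree at most $d$ and total degree at most $D$ such that $P(Z_\ell)=\alpha_\ell$ for all $\ell\in\binom{[n]}{\le D}_d$, and there is an algorithm that computes (the coefficients of) $P$ from the values $(\alpha_\ell)_\ell$ using at most $\binom{n}{\le D}_d\cdot\mathrm{poly}(n,d)$ field operations.
   Context: Field operations are assumed to cost unit time. For $\ell\in\{0,\dots,d\}^n$ write $Z_\ell=(z_{1,\ell_1},\dots,z_{n,\ell_n})$. The set $\binom{[n]}{\le D}_d$ is $\{\ell\in\{0,\dots,d\}^n:\ell_1+\dots+\ell_n\le D\}$, and $\binom{n}{\le D}_d$ is its cardinality. The individual degree of a polynomial is the largest exponent of a single variable in a monomial; the total degree is the largest sum of exponents of a monomial. *)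

(* Defs.v *)
From mathcomp Require Import all_boot all_order all_algebra.
From mathcomp Require Import mpoly.

Set Implicit Arguments.
Unset Strict Implicit.
Unset Printing Implicit Defensive.

Import Order.TTheory GRing.Theory Num.Theory.
Local Open Scope ring_scope.

(** * Multi-indices, grids and degrees *)

(* The multi-indices in {0,...,d}^n of weight at most D; D may be negative,
   in which case there are none. *)
Definition midx (n d : nat) (D : int) : {set {ffun 'I_n -> 'I_d.+1}} :=
  [set l : {ffun 'I_n -> 'I_d.+1} | ((\sum_(i < n) l i)%N)%:Z <= D].

Definition grid_point (F : fieldType) (n d : nat) (z : 'I_n -> 'I_d.+1 -> F)
  (l : {ffun 'I_n -> 'I_d.+1}) : 'I_n -> F := fun i => z i (l i).

Definition mnm_of (n d : nat) (l : {ffun 'I_n -> 'I_d.+1}) : 'X_{1..n} :=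
  [multinom (l i : nat) | i < n].

Definition indiv_deg (F : fieldType) (n : nat) (P : {mpoly F[n]}) : nat :=
  \max_(m <- msupp P) \max_(i < n) m i.

Definition total_deg (F : fieldType) (n : nat) (P : {mpoly F[n]}) : nat :=
  \max_(m <- msupp P) mdeg m.

(* The zero polynomial has total degree -oo, so it satisfies every degree
   bound, including the negative ones (total_deg 0 is the dummy value 0). *)
Definition total_deg_le (F : fieldType) (n : nat) (P : {mpoly F[n]})
  (D : int) : Prop := P != 0 -> (total_deg P)%:Z <= D.

(* Only the values of a on midx n d D matter. *)
Definition interpolates (F : fieldType) (n d : nat) (D : int)
    (z : 'I_n -> 'I_d.+1 -> F) (a : {ffun 'I_n -> 'I_d.+1} -> F)
    (P : {mpoly F[n]}) : Prop :=
  [/\ (indiv_deg P <= d)%N, total_deg_le P D &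
      forall l, l \in midx n d D -> P.@[grid_point z l] = a l].

(** * Algorithms over a field

   A while-language with integer variables and arrays of field elements.
   Programs do not mention the field.  Integers serve for control flow and for
   addressing; the only flow of information from field elements to integers is
   through the equality test of field elements. *)

Inductive iexp : Type :=
| ILit of int
| IVar of nat
| IAdd of iexp & iexp
| ISub of iexp & iexp
| IMul of iexp & iexp
| IDiv of iexp & iexp
| IMod of iexp & iexp.

Inductive fop : Type := FAdd | FSub | FMul | FDiv.

(* The cell of the given array whose index is the value of the expression. *)
Definition floc : Type := (nat * iexp)%type.

Inductive prog : Type :=
| Skip
| Seq of prog & prog
| IAssign of nat & iexp
| FConst of floc & bool               (* the constant 0 or 1 *)
| FMove of floc & floc
| FOp of floc & fop & floc & floc     (* FOp r o x y is r := x o y *)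
| IfLe of iexp & iexp & prog & prog   (* comparison of integers *)
| IfFEq of floc & floc & prog & prog  (* equality test in the field *)
| WhileLe of iexp & iexp & prog.

Record state (F : fieldType) : Type :=
  State { ivar : nat -> int; farr : nat * int -> F }.

Fixpoint ieval (v : nat -> int) (e : iexp) : int :=
  match e with
  | ILit k => k
  | IVar x => v x
  | IAdd e1 e2 => ieval v e1 + ieval v e2
  | ISub e1 e2 => ieval v e1 - ieval v e2
  | IMul e1 e2 => ieval v e1 * ieval v e2
  | IDiv e1 e2 => (ieval v e1 %/ ieval v e2)%Z
  | IMod e1 e2 => (ieval v e1 %% ieval v e2)%Z
  end.

Definition feval (F : fieldType) (o : fop) (x y : F) : F :=
  match o with
  | FAdd => x + y
  | FSub => x - y
  | FMul => x * y
  | FDiv => x / y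
  end.

Definition faddr (F : fieldType) (s : state F) (r : floc) : nat * int :=
  (r.1, ieval (ivar s) r.2).

Definition fget (F : fieldType) (s : state F) (r : floc) : F :=
  farr s (faddr s r).

Definition iset (F : fieldType) (s : state F) (x : nat) (k : int) : state F :=
  State [eta ivar s with x |-> k] (farr s).

Definition fset (F : fieldType) (s : state F) (r : floc) (x : F) : state F :=
  State (ivar s) [eta farr s with faddr s r |-> x].

(* exec c s k t: started in s, the program c halts in t after exactly k field
   operations, i.e. additions, subtractions, multiplications, divisions and
   equality tests.  There is no rule for dividing by zero: such a run is stuck,
   so that the convention 0^-1 = 0 cannot be exploited. *)
Inductive exec (F : fieldType) : prog -> state F -> nat -> state F -> Prop :=
| ESkip s : exec Skip s 0 s
| ESeq c1 c2 s t u k1 k2 :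
    exec c1 s k1 t -> exec c2 t k2 u -> exec (Seq c1 c2) s (k1 + k2) u
| EIAssign s x e : exec (IAssign x e) s 0 (iset s x (ieval (ivar s) e))
| EFConst s r b : exec (FConst r b) s 0 (fset s r (b : nat)%:R)
| EFMove s r r1 : exec (FMove r r1) s 0 (fset s r (fget s r1))
| EFOp s r o r1 r2 : (o = FDiv -> fget s r2 != 0) ->
    exec (FOp r o r1 r2) s 1 (fset s r (feval o (fget s r1) (fget s r2)))
| EIfLe s t k e1 e2 c1 c2 :
    exec (if ieval (ivar s) e1 <= ieval (ivar s) e2 then c1 else c2) s k t ->
    exec (IfLe e1 e2 c1 c2) s k t
| EIfFEq s t k r1 r2 c1 c2 :
    exec (if fget s r1 == fget s r2 then c1 else c2) s k t ->
    exec (IfFEq r1 r2 c1 c2) s k.+1 t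
| EWhileLe s t k e1 e2 c :
    exec (if ieval (ivar s) e1 <= ieval (ivar s) e2
          then Seq c (WhileLe e1 e2 c) else Skip) s k t ->
    exec (WhileLe e1 e2 c) s k t.

Lemma exec_det (F : fieldType) (c : prog) (s t t' : state F) (k k' : nat) :
  exec c s k t -> exec c s k' t' -> k = k' /\ t = t'.
Proof.
move=> h; elim: h k' t' => {c s k t}.
- by move=> s k' t' h; inversion h.
- move=> c1 c2 s t u k1 k2 _ IH1 _ IH2 k' t' h; inversion h; subst.
  by have [-> e] := IH1 _ _ H1; subst; have [-> ->] := IH2 _ _ H5.
- by move=> s x e k' t' h; inversion h.
- by move=> s r b k' t' h; inversion h.
- by move=> s r r1 k' t' h; inversion h.
- by move=> s r o r1 r2 _ k' t' h; inversion h.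
- by move=> s t k e1 e2 c1 c2 _ IH k' t' h; inversion h; subst; apply: IH.
- move=> s t k r1 r2 c1 c2 _ IH k' t' h; inversion h; subst.
  by have [-> ->] := IH _ _ H6.
- by move=> s t k e1 e2 c _ IH k' t' h; inversion h; subst; apply: IH.
Qed.

(** * Input and output conventions *)

(* Families indexed by {0,...,d}^n are stored at the index whose digits in base
   d + 1 are the entries of the multi-index. *)
Definition midx_code (n d : nat) (l : {ffun 'I_n -> 'I_d.+1}) : int :=
  ((\sum_(i < n) l i * d.+1 ^ i)%N)%:Z.

(* Variables 0, 1, 2 hold n, d, D; array 0 holds the grid row by row; array 1
   holds the values.  All the rest of the initial state is arbitrary. *)
Definition input_state (F : fieldType) (n d : nat) (D : int)
    (z : 'I_n -> 'I_d.+1 -> F) (a : {ffun 'I_n -> 'I_d.+1} -> F)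
    (s : state F) : Prop :=
  [/\ [/\ ivar s 0%N = n%:Z, ivar s 1%N = d%:Z & ivar s 2%N = D],
      forall (i : 'I_n) (j : 'I_d.+1),
        farr s (0%N, ((i * d.+1 + j)%N)%:Z) = z i j &
      forall l, l \in midx n d D -> farr s (1%N, midx_code l) = a l].

(* Array 2 holds the coefficients of P.  Those of the monomials outside
   midx n d D are zero by the degree bounds and are not required. *)
Definition output_state (F : fieldType) (n d : nat) (D : int)
    (P : {mpoly F[n]}) (t : state F) : Prop :=
  forall l : {ffun 'I_n -> 'I_d.+1}, l \in midx n d D ->
    farr t (2%N, midx_code l) = P@_(mnm_of l).

Definition eval2 (p : {mpoly int[2]}) (n d : nat) : int :=
  p.@[fun i : 'I_2 => if i == 0 then n%:Z else d%:Z].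

(* Main.v *)
(** The set S of admissible multi-indices is a down-set.  In the Newton basis
[prod_i prod_(t < m_i) (X_i - z_(i,t))] the coefficients are related to the
values by a tensor product of lower triangular matrices, and to the monomial
coefficients by a tensor product of upper unitriangular ones; on a down-set both
systems stay triangular, hence are uniquely solvable.  Each of the two tensor
products is inverted one coordinate at a time, by d elementary steps which only
combine pairs of cells of S: first the eliminations
[A l := (A l - A (l with l_i := k)) / (z_(i,l_i) - z_(i,k))], then the Horner
steps [A l := A l - z_(i,k) * A (l + e_i)].  This is 2nd stages of at most three
operations per cell of S.  Integer operations are free, so the program scans all
(d + 1)^n codes at each stage, skipping those outside S, and keeps one copy of
the table per stage instead of updating it in place. *)

Require Import Defs.
From mathcomp Require Import all_boot all_order all_algebra.
From mathcomp Require Import mpoly zify ring.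

Set Implicit Arguments.
Unset Strict Implicit.
Unset Printing Implicit Defensive.

Import Order.TTheory GRing.Theory Num.Theory.
Local Open Scope ring_scope.

(** * Triangular systems and the Newton basis *)

(** Induction on [#|S|], setting aside a point [x] of maximal weight: its column vanishes in all
    other rows, so a solution on the rest survives and row [x] fixes the value at [x]. *)
Lemma triangular_solve (F : fieldType) (T : finType) (w : T -> nat)
    (A : T -> T -> F) (S : {set T}) (a : T -> F) :
  (forall l, l \in S -> A l l != 0) ->
  (forall l m, l \in S -> m \in S -> m != l -> (w l <= w m)%N -> A l m = 0) ->
  exists c : T -> F, forall l, l \in S -> \sum_(m in S) A l m * c m = a l.
Proof.
elim: {S}#|S| {-2}S (erefl #|S|) => [|n IHn] S cardS Adiag Atri.
  by exists (fun=> 0) => l; rewrite (cards0_eq cardS) inE.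
have [x0 x0S] : exists x, x \in S by apply/card_gt0P; rewrite cardS.
case: (arg_maxnP w x0S) => x /[dup] xS' _ xmax; have {xS'} xS : x \in S by [].
have [||l m|c cP] := IHn (S :\ x).
- by move: cardS; rewrite (cardsD1 x) xS add1n => -[].
- by move=> l /setD1P[_]; apply: Adiag.
- by move=> /setD1P[_ lS] /setD1P[_ mS]; apply: Atri.
pose y := (a x - \sum_(m in S :\ x) A x m * c m) / A x x.
exists (fun m => if m == x then y else c m) => l lS.
have sumE l' : \sum_(m in S) A l' m * (if m == x then y else c m)
    = A l' x * y + \sum_(m in S :\ x) A l' m * c m.
  rewrite (big_setD1 x) //= eqxx; congr (_ + _).
  by apply: eq_bigr => m /setD1P[/negPf-> _].
rewrite sumE; have [->|l_x] := eqVneq l x.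
  by rewrite /y mulrC divfK ?subrK // Adiag.
have lSx : l \in S :\ x by rewrite !inE l_x.
rewrite cP // Atri ?mul0r ?add0r //; first by rewrite eq_sym.
exact: xmax.
Qed.

(** Strong induction on [w l]: in row [l] the terms of smaller weight cancel, the others vanish off
    the diagonal. *)
Lemma triangular_inj (F : fieldType) (T : finType) (w : T -> nat)
    (A : T -> T -> F) (S : {set T}) (c c' : T -> F) :
  (forall l, l \in S -> A l l != 0) ->
  (forall l m, l \in S -> m \in S -> m != l -> (w l <= w m)%N -> A l m = 0) ->
  {in S, forall l, \sum_(m in S) A l m * c m = \sum_(m in S) A l m * c' m} ->
  {in S, c =1 c'}.
Proof.
move=> Adiag Atri eqA l; have [n] := ubnP (w l); elim: n l => // n IHn l.
rewrite ltnS => wl lS; have := eqA l lS.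
rewrite !(big_setD1 l lS) /= => /eqP; rewrite -subr_eq0 opprD addrACA -sumrB.
rewrite big1 => [|m /setD1P[m_l mS]].
  rewrite addr0 -mulrBr mulf_eq0 (negPf (Adiag _ lS)) /= subr_eq0.
  by move/eqP.
have [lem|ltm] := leqP (w l) (w m); first by rewrite Atri // !mul0r subr0.
by rewrite IHn ?subrr //; apply: leq_trans wl.
Qed.

(** * One-variable Newton matrices and their elimination steps *)

Section Newton.

Variables (F : fieldType) (z : nat -> F).

Definition newton_poly (k m : nat) : {poly F} :=
  \prod_(k <= t < m) ('X - (z t)%:P).

Lemma newton_polyn k : newton_poly k k = 1.
Proof. by rewrite /newton_poly big_geq. Qed.

Lemma newton_poly_recl k m : (k < m)%N ->
  newton_poly k m = ('X - (z k)%:P) * newton_poly k.+1 m.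
Proof. by move=> km; rewrite /newton_poly big_ltn. Qed.

Lemma size_newton_poly k m : size (newton_poly k m) = (m - k).+1.
Proof. by rewrite /newton_poly size_prod_XsubC size_iota. Qed.

(* Row [j] of the matrix taking Newton coefficients to the values at [z j],
   after the first [k] elimination steps. *)
Definition eval_mx (k j m : nat) : F :=
  if (j < k)%N then (j == m)%:R
  else if (k <= m)%N then (newton_poly k m).[z j] else 0.

(* Row [j] of the matrix taking Newton coefficients to coefficients in the basis
   [(X - z 0) ... (X - z (min j k - 1)) X^(j - min j k)]. *)
Definition coef_mx (k j m : nat) : F :=
  if (j < k)%N then (j == m)%:R
  else if (k <= m)%N then (newton_poly k m)`_(j - k) else 0.

(** A divided difference: for [k < m] the product vanishes at [z k] and the division removes its
    first factor; for [m = k] two values 1 cancel. *)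
Lemma eval_mxS k j m : (k < j)%N -> z j != z k ->
  eval_mx k.+1 j m = (eval_mx k j m - eval_mx k k m) / (z j - z k).
Proof.
move=> kj zjk; have zjk0 : z j - z k != 0 by rewrite subr_eq0.
rewrite /eval_mx ltnn ![(j < _)%N]ltnNge (ltnW kj) kj /=.
case: ltngtP => [km|//|<-]; rewrite ?subrr ?mul0r //.
  rewrite (newton_poly_recl km) !hornerE subrr mul0r subr0.
  by rewrite mulrC mulrA mulVf ?mul1r.
by rewrite newton_polyn !hornerE subrr mul0r.
Qed.

(** Row [k] is already a unit row after [k] steps, since [newton_poly k m] vanishes at [z k] once
    [k < m]. *)
Lemma eval_mxS_id k j m : (j <= k)%N -> eval_mx k.+1 j m = eval_mx k j m.
Proof.
rewrite /eval_mx ltnS => jk; rewrite jk; case: ltngtP jk => // -> _.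
case: ltngtP => [km||<-] //; last by rewrite newton_polyn hornerE.
by rewrite (newton_poly_recl km) !hornerE subrr mul0r.
Qed.

Lemma eval_mx_id d j m : (j <= d)%N -> (m <= d)%N ->
  eval_mx d j m = (j == m)%:R.
Proof.
move=> jd md; rewrite /eval_mx; case: ltngtP jd => // -> _.
by case: ltngtP md => // <- _; rewrite newton_polyn hornerE.
Qed.

Lemma eval_mx0 j m : eval_mx 0 j m = (newton_poly 0 m).[z j].
Proof. by []. Qed.

Lemma eval_mx_tri j m : (j < m)%N -> eval_mx 0 j m = 0.
Proof.
move=> jm; rewrite eval_mx0 /newton_poly horner_prod; apply/eqP.
rewrite prodf_seq_eq0; apply/hasP; exists j.
  by rewrite mem_index_iota.
by rewrite /= !hornerE subrr.
Qed.

Lemma eval_mx_diag j : (forall t, (t < j)%N -> z t != z j) ->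
  eval_mx 0 j j != 0.
Proof.
move=> zj; rewrite eval_mx0 /newton_poly horner_prod prodf_seq_neq0.
apply/allP => t; rewrite mem_index_iota => /andP[_ tj] /=.
by rewrite !hornerE subr_eq0 eq_sym zj.
Qed.

(** Splitting off the factor ['X - z k] and comparing coefficients. The recursion is run downwards,
    from the identity at [k = d] to the monomial basis at [k = 0]. *)
Lemma coef_mxS k j m : (k <= j)%N ->
  coef_mx k j m = coef_mx k.+1 j m - z k * coef_mx k.+1 j.+1 m.
Proof.
move=> kj; rewrite /coef_mx !ltnS [(j < k)%N]ltnNge kj /=.
have [jk|kj'] := leqP j k.
  have {jk kj} -> : j = k by apply/eqP; rewrite eqn_leq jk.
  rewrite !subnn; case: ltngtP => [km|_|<-]; rewrite ?mulr0 ?subr0 //.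
    by rewrite (newton_poly_recl km) mulrBl coefB coefXM mul_polyC coefZ.
  by rewrite newton_polyn coef1.
case: ltngtP => [km|_|<-]; rewrite ?mulr0 ?subr0 //.
  rewrite (newton_poly_recl km) mulrBl coefB coefXM mul_polyC coefZ.
  by rewrite subSS -[(j - k)%N]prednK ?subn_gt0 //= -subnS.
by rewrite newton_polyn coef1 subn_eq0 leqNgt kj'.
Qed.

Lemma coef_mxS_id k j m : (j < k)%N -> coef_mx k j m = coef_mx k.+1 j m.
Proof. by move=> jk; rewrite /coef_mx jk ltnS ltnW. Qed.

Lemma coef_mx_id d j m : (j <= d)%N -> (m <= d)%N ->
  coef_mx d j m = (j == m)%:R.
Proof.
move=> jd md; rewrite /coef_mx; case: ltngtP jd => // -> _.
by case: ltngtP md => // <- _; rewrite newton_polyn coef1 subnn.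
Qed.

Lemma coef_mx_tri k j m : (m < j)%N -> coef_mx k j m = 0.
Proof.
move=> mj; rewrite /coef_mx; case: ltnP => [jk|kj].
  by rewrite gtn_eqF.
case: ifP => // km; rewrite nth_default // size_newton_poly; lia.
Qed.

Lemma coef_mx0 j m : coef_mx 0 j m = (newton_poly 0 m)`_j.
Proof. by rewrite /coef_mx subn0. Qed.

Lemma coef_mx_diag j : coef_mx 0 j j = 1.
Proof.
rewrite coef_mx0; have /monicP := monic_prod_XsubC (index_iota 0 j) xpredT z.
by rewrite lead_coefE size_newton_poly subn0.
Qed.

End Newton.

(** * Multi-indices and tensor products of triangular matrices *)

Section MultiIndices.

Variables (F : fieldType) (n d : nat).
Implicit Types (l : {ffun 'I_n -> 'I_d.+1}) (D : int).
Implicit Types (M : 'I_n -> nat -> nat -> F) (S : {set {ffun 'I_n -> 'I_d.+1}}).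
Implicit Types (a b c : {ffun 'I_n -> 'I_d.+1} -> F).

Definition weight l : nat := (\sum_(i < n) l i)%N.

Lemma in_midx D l : (l \in midx n d D) = ((weight l)%:Z <= D).
Proof. by rewrite inE. Qed.

Lemma weight_le l : (weight l <= n * d)%N.
Proof.
rewrite -[X in (_ <= X * _)%N]card_ord -sum_nat_const leq_sum // => i _.
by rewrite -ltnS.
Qed.

(** Otherwise [m] lies below [l] in every coordinate and differs from it, so its weight is smaller.
    This turns triangularity in each coordinate into triangularity for the weight. *)
Lemma exists_coord_lt l (m : {ffun 'I_n -> 'I_d.+1}) :
  m != l -> (weight l <= weight m)%N -> exists i, (l i < m i)%N.
Proof.
move=> ml lem; case: (pickP (fun i => l i < m i)%N) => [i lti|ge].
  by exists i.
have le i : (m i <= l i)%N by rewrite leqNgt ge.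
case/eqP: ml; apply/ffunP => i; apply/val_inj/eqP; rewrite eqn_leq le /= leqNgt.
apply/negP => lt; have : (weight m < weight l)%N; last by rewrite ltnNge lem.
rewrite /weight (bigD1 i) //= [X in (_ < X)%N](bigD1 i) //= -addSn.
by apply: leq_add => //; apply: leq_sum.
Qed.

Definition upd l (i : 'I_n) (x : 'I_d.+1) : {ffun 'I_n -> 'I_d.+1} :=
  [ffun i' => if i' == i then x else l i'].

Lemma weight_upd l i x : (weight (upd l i x) + l i = weight l + x)%N.
Proof.
rewrite /weight (bigD1 i) //= [X in (_ = X + _)%N](bigD1 i) //= ffunE eqxx.
rewrite (eq_bigr (fun i' => l i' : nat)) => [|i' /negPf i'i].
  by rewrite addnC addnA addnAC.
by rewrite ffunE i'i.
Qed.

Definition tensor_apply (M : 'I_n -> nat -> nat -> F)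
    (S : {set {ffun 'I_n -> 'I_d.+1}})
    (c : {ffun 'I_n -> 'I_d.+1} -> F) l : F :=
  \sum_(m in S) (\prod_(i < n) M i (l i) (m i)) * c m.

(** A tensor product is linear in its row at coordinate [i], and [l] and [upd l i x] share all other
    rows. Hence a row operation in one coordinate combines pairs of cells, whatever [S] is. *)
Lemma tensor_apply_upd M M' S c l (i : 'I_n) (x : 'I_d.+1) (u v : F) :
  (forall i' (m : nat), i' != i -> M' i' (l i') m = M i' (l i') m) ->
  (forall m, (m <= d)%N -> M' i (l i) m = u * M i (l i) m + v * M i x m) ->
  tensor_apply M' S c l
    = u * tensor_apply M S c l + v * tensor_apply M S c (upd l i x).
Proof.
move=> eqM' M'i; rewrite !mulr_sumr -big_split; apply: eq_bigr => m _ /=.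
rewrite !mulrA -mulrDl; congr (_ * _).
have prodE (G : 'I_n -> F) : \prod_j G j = G i * \prod_(j | j != i) G j.
  by rewrite (bigD1 i).
rewrite (prodE (fun j => M' j _ _)) (prodE (fun j => M j (l j) _)).
rewrite (prodE (fun j => M j (upd l i x j) _)) M'i ?leq_ord //.
rewrite ffunE eqxx mulrDl !mulrA.
congr (_ * _ + _ * _); apply: eq_bigr => i' i'i; rewrite ?eqM' //.
by rewrite ffunE (negPf i'i).
Qed.

Lemma tensor_apply_same M M' S c l :
  (forall i (m : nat), (m <= d)%N -> M' i (l i) m = M i (l i) m) ->
  tensor_apply M' S c l = tensor_apply M S c l.
Proof.
move=> eqM; apply: eq_bigr => m _; congr (_ * _); apply: eq_bigr => i _.
by rewrite eqM // -ltnS.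
Qed.

Lemma tensor_apply_id M S c l : l \in S ->
  (forall i j m, (j <= d)%N -> (m <= d)%N -> M i j m = (j == m)%:R) ->
  tensor_apply M S c l = c l.
Proof.
move=> lS Mid; rewrite /tensor_apply (bigD1 l) //= [X in X * _]big1 => [|i _].
  rewrite mul1r big1 ?addr0 // => m /andP[_ ml].
  suff [i mli] : exists i, l i != m i.
    by rewrite (bigD1 i) //= Mid ?leq_ord // val_eqE (negPf mli) !mul0r.
  apply/existsP; rewrite -negb_forall; apply: contra ml => /forallP lm.
  by apply/eqP/ffunP => i; apply/esym/eqP/lm.
by rewrite Mid ?leq_ord // eqxx.
Qed.

(** Every admissible [m] has smaller weight than [l], hence a coordinate with [m i < l i]. Cells
    outside the set thus count as 0. *)
Lemma tensor_apply_upper0 M D c l :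
  (forall i (j m : nat), (m < j)%N -> M i j m = 0) ->
  l \notin midx n d D -> tensor_apply M (midx n d D) c l = 0.
Proof.
move=> Mtri lS; apply: big1 => m mS.
suff [i mli] : exists i, (m i < l i)%N.
  by rewrite (bigD1 i) //= Mtri // !mul0r.
have ml : l != m by apply: contraNneq lS => ->.
apply: exists_coord_lt => //; move: lS mS; rewrite !in_midx -ltNge; lia.
Qed.

Lemma lower_triangular_weight M l (m : {ffun 'I_n -> 'I_d.+1}) :
  (forall i (j k : nat), (j < k)%N -> M i j k = 0) ->
  m != l -> (weight l <= weight m)%N -> \prod_(i < n) M i (l i) (m i) = 0 :> F.
Proof.
move=> Mtri ml lem; have [i lti] := exists_coord_lt ml lem.
by rewrite (bigD1 i) //= Mtri ?mul0r.
Qed.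

(** Complementing the weight to [n * d] reverses the order, as [triangular_solve] requires for upper
    triangular systems. *)
Lemma upper_triangular_weight M l (m : {ffun 'I_n -> 'I_d.+1}) :
  (forall i (j k : nat), (k < j)%N -> M i j k = 0) ->
  m != l -> (n * d - weight l <= n * d - weight m)%N ->
  \prod_(i < n) M i (l i) (m i) = 0 :> F.
Proof.
move=> Mtri; rewrite eq_sym => ml lem.
have {lem} lem : (weight m <= weight l)%N.
  by move: lem (weight_le l) (weight_le m); lia.
have [i lti] := exists_coord_lt ml lem.
by rewrite (bigD1 i) //= Mtri ?mul0r.
Qed.

Lemma tensor_lower_solve M S a :
  (forall i (j m : nat), (j < m)%N -> M i j m = 0) ->
  (forall i (j : 'I_d.+1), M i j j != 0) ->
  exists c, {in S, tensor_apply M S c =1 a}.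
Proof.
move=> Mtri Mdiag.
apply: (triangular_solve (w := weight)
  (A := fun l m => \prod_i M i (l i) (m i))).
  by move=> l _; apply/prodf_neq0.
by move=> l m _ _; apply: lower_triangular_weight.
Qed.

Lemma tensor_upper_solve M S a :
  (forall i (j m : nat), (m < j)%N -> M i j m = 0) ->
  (forall i (j : 'I_d.+1), M i j j != 0) ->
  exists c, {in S, tensor_apply M S c =1 a}.
Proof.
move=> Mtri Mdiag.
apply: (triangular_solve (w := fun l => (n * d - weight l)%N)
  (A := fun l m => \prod_i M i (l i) (m i))).
  by move=> l _; apply/prodf_neq0.
by move=> l m _ _; apply: upper_triangular_weight.
Qed.

Lemma tensor_lower_inj M S c c' :
  (forall i (j m : nat), (j < m)%N -> M i j m = 0) ->
  (forall i (j : 'I_d.+1), M i j j != 0) ->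
  {in S, tensor_apply M S c =1 tensor_apply M S c'} -> {in S, c =1 c'}.
Proof.
move=> Mtri Mdiag.
apply: (@triangular_inj _ _ weight (fun l m => \prod_i M i (l i) (m i))).
  by move=> l _; apply/prodf_neq0.
by move=> l m _ _; apply: lower_triangular_weight.
Qed.

Lemma mnm_of_inj : injective (@mnm_of n d).
Proof.
move=> l m /mnmP eqlm; apply/ffunP => i; apply/val_inj.
by have := eqlm i; rewrite !mnmE.
Qed.

Lemma mdeg_mnm_of l : mdeg (mnm_of l) = weight l.
Proof. by rewrite mdegE; apply: eq_bigr => i _; rewrite mnmE. Qed.

Definition poly_of D (b : {ffun 'I_n -> 'I_d.+1} -> F) : {mpoly F[n]} :=
  \sum_(l in midx n d D) b l *: 'X_[mnm_of l].

Lemma coef_poly_of D b mu : (poly_of D b)@_mu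
  = \sum_(l in midx n d D | mnm_of l == mu) b l.
Proof.
rewrite raddf_sum /= big_mkcondr; apply: eq_bigr => l _.
by rewrite mcoeffZ mcoeffX; case: eqP; rewrite ?mulr1 ?mulr0.
Qed.

Lemma msupp_poly_of D b mu : mu \in msupp (poly_of D b) ->
  exists2 l, l \in midx n d D & mu = mnm_of l.
Proof.
rewrite mcoeff_msupp coef_poly_of => nz.
case: (pickP (fun l => (l \in midx n d D) && (mnm_of l == mu))) => [l|no].
  case/andP=> lS /eqP<-.
  by exists l.
by rewrite big_pred0 ?eqxx in nz.
Qed.

Lemma indiv_deg_poly_of D b : (indiv_deg (poly_of D b) <= d)%N.
Proof.
apply/bigmax_leqP_seq => mu /msupp_poly_of[l _ ->] _.
by apply/bigmax_leqP => i _; rewrite mnmE -ltnS.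
Qed.

Lemma total_deg_poly_of D b : total_deg_le (poly_of D b) D.
Proof.
move=> nz.
have [mu muP] : exists mu, mu \in msupp (poly_of D b).
  case: (msupp (poly_of D b)) (msupp_eq0 (poly_of D b)) => [/esym|mu r _].
    by rewrite eqxx (negPf nz).
  by exists mu; rewrite mem_head.
have [l] := msupp_poly_of muP; rewrite in_midx => lD _.
(* Some monomial has weight at most [D], so [D] is nonnegative. *)
case: D lD {mu muP} nz => // D lD nz.
apply/bigmax_leqP_seq => mu /msupp_poly_of[m]; rewrite in_midx => mD -> _.
by rewrite mdeg_mnm_of.
Qed.

Lemma poly_of_coef D (P : {mpoly F[n]}) :
  (indiv_deg P <= d)%N -> total_deg_le P D ->
  P = poly_of D (fun l => P@_(mnm_of l)).
Proof.
move=> /bigmax_leqP_seq Pd PD; apply/mpolyP => mu; rewrite coef_poly_of.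
have [muP|muNP] := boolP (mu \in msupp P); last first.
  rewrite memN_msupp_eq0 // big1 // => l /andP[_ /eqP->].
  by rewrite memN_msupp_eq0.
have mud i : (mu i <= d)%N by move/bigmax_leqP: (Pd _ muP isT) => ->.
have [l lE] : exists l : {ffun 'I_n -> 'I_d.+1}, mnm_of l = mu.
  exists [ffun i => inord (mu i)]; apply/mnmP => i.
  by rewrite mnmE ffunE inordK // ltnS.
rewrite (big_pred1 l) ?lE // => m.
rewrite /= -lE (inj_eq mnm_of_inj); case: eqP => [->|]; last by rewrite andbF.
rewrite andbT in_midx -mdeg_mnm_of lE; apply: le_trans (PD _); last first.
  by apply: contraTneq muP => ->; rewrite msupp0.
by rewrite lez_nat; apply: (leq_bigmax_seq (F := @mdeg n)).
Qed.

Variable z : 'I_n -> 'I_d.+1 -> F.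

(** Indexing by [nat] suits the one-variable matrices; for [t > d] the value is a meaningless
    default. *)
Definition node (i : 'I_n) (t : nat) : F := z i (inord t).

(** [kappa i] is the level reached in coordinate [i]; the coordinates may be at different levels. *)
Definition eval_stage (kappa : 'I_n -> nat) (i : 'I_n) :=
  eval_mx (node i) (kappa i).

Definition coef_stage (kappa : 'I_n -> nat) (i : 'I_n) :=
  coef_mx (node i) (kappa i).

Lemma meval_poly_of D b c l :
  {in midx n d D, tensor_apply (coef_stage (fun=> 0%N)) (midx n d D) c =1 b} ->
  (poly_of D b).@[grid_point z l]
    = tensor_apply (eval_stage (fun=> 0%N)) (midx n d D) c l.
Proof.
move=> cb; rewrite /poly_of raddf_sum /=.
pose C := coef_stage (fun=> 0%N).
transitivity (\sum_(m : {ffun 'I_n -> 'I_d.+1})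
    tensor_apply C (midx n d D) c m * \prod_(i < n) z i (l i) ^+ m i).
  (* The coefficients vanish outside the admissible set, so the sum may run over the whole box,
     where a sum of products factors by coordinates. *)
  rewrite big_mkcond; apply: eq_bigr => m _; case: ifP => [mS|/negbT mS].
    rewrite mevalZ mevalX cb //; congr (_ * _).
    by apply: eq_bigr => i _; rewrite mnmE.
  rewrite tensor_apply_upper0 ?mul0r // => i j k; exact: coef_mx_tri.
under eq_bigr => m _ do rewrite mulr_suml.
rewrite exchange_big; apply: eq_bigr => k _ /=.
under eq_bigr => m _ do rewrite mulrAC -big_split /=.
rewrite -mulr_suml; congr (_ * _).
rewrite -(bigA_distr_bigA
  (fun i (j : 'I_d.+1) => C i j (k i) * z i (l i) ^+ j)).
apply: eq_bigr => i _; rewrite /eval_stage eval_mx0 /node inord_val.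
rewrite (@horner_coef_wide _ d.+1); last by rewrite size_newton_poly subn0.
by apply: eq_bigr => j _; rewrite /C /coef_stage coef_mx0.
Qed.

Lemma eval_stage0_tri i j m : (j < m)%N -> eval_stage (fun=> 0%N) i j m = 0.
Proof. exact: eval_mx_tri. Qed.

Lemma coef_stage_tri kappa i j m : (m < j)%N -> coef_stage kappa i j m = 0.
Proof. exact: coef_mx_tri. Qed.

Lemma coef_stage0_diag i (j : 'I_d.+1) : coef_stage (fun=> 0%N) i j j != 0.
Proof. by rewrite /coef_stage coef_mx_diag oner_eq0. Qed.

Hypothesis z_inj : forall i, injective (z i).

Lemma node_neq i t j : (t < j)%N -> (j <= d)%N -> node i j != node i t.
Proof.
move=> tj jd; rewrite /node (inj_eq (@z_inj i)) -val_eqE /= !inordK ?gtn_eqF //.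
by rewrite ltnS (leq_trans (ltnW tj)).
Qed.

Lemma eval_stage0_diag i (j : 'I_d.+1) : eval_stage (fun=> 0%N) i j j != 0.
Proof.
apply: eval_mx_diag => t tj; rewrite eq_sym node_neq // -ltnS; exact: ltn_ord.
Qed.

(** The upper triangular system gives the Newton coefficients of [P], and evaluating [P] through
    them gives [a]. Both uniqueness and the correctness of the program rest on them. *)
Lemma interpolates_newton D a P : interpolates D z a P ->
  exists c, {in midx n d D,
      tensor_apply (coef_stage (fun=> 0%N)) (midx n d D) c
        =1 fun l => P@_(mnm_of l)}
    /\ {in midx n d D,
      tensor_apply (eval_stage (fun=> 0%N)) (midx n d D) c =1 a}.
Proof.
move=> [Pd PD Pa].
have [c cP] := tensor_upper_solve (midx n d D) (fun l => P@_(mnm_of l))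
  (@coef_stage_tri _) coef_stage0_diag.
exists c; split=> // l lS; rewrite -Pa // [P in RHS](poly_of_coef Pd PD).
exact/esym/meval_poly_of.
Qed.

(** Existence solves the lower triangular system for the Newton coefficients; uniqueness is its
    injectivity. *)
Lemma interpolates_unique D a : exists! P : {mpoly F[n]}, interpolates D z a P.
Proof.
have [c cP] :=
  tensor_lower_solve (midx n d D) a eval_stage0_tri eval_stage0_diag.
exists (poly_of D (tensor_apply (coef_stage (fun=> 0%N)) (midx n d D) c)).
split.
  split; [exact: indiv_deg_poly_of|exact: total_deg_poly_of|move=> l lS].
  by rewrite (@meval_poly_of D _ c) ?cP.
move=> Q Qint; have [c' [c'Q c'a]] := interpolates_newton Qint.
have [Qd QD _] := Qint; rewrite [Q](poly_of_coef Qd QD).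
apply: eq_bigr => l lS; congr (_ *: _); rewrite -c'Q //.
apply: eq_bigr => m mS; congr (_ * _).
apply: (tensor_lower_inj eval_stage0_tri eval_stage0_diag) mS => m' m'S.
by rewrite cP ?c'a.
Qed.

End MultiIndices.

(** * Stages of the algorithm *)

Section Tables.

Variables (F : fieldType) (n d : nat) (D : int) (z : 'I_n -> 'I_d.+1 -> F).
Variable c : {ffun 'I_n -> 'I_d.+1} -> F.
Hypothesis z_inj : forall i, injective (z i).
Implicit Types (l : {ffun 'I_n -> 'I_d.+1}) (i : 'I_n) (u k : nat).

(* Step [u = i * d + k] is the [k]-th step in coordinate [i]; after [u] steps,
   [steps_done u i] of them concern coordinate [i]. *)
Definition steps_done u i : nat := minn d (u - i * d).

Definition eval_table u : {ffun 'I_n -> 'I_d.+1} -> F :=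
  tensor_apply (eval_stage z (steps_done u)) (midx n d D) c.

(** Horner steps lower the level of [coef_mx], hence the subtraction from [d]. *)
Definition coef_table u : {ffun 'I_n -> 'I_d.+1} -> F :=
  tensor_apply (coef_stage z (fun i => d - steps_done u i)%N) (midx n d D) c.

Lemma steps_done_cur i k : (k <= d)%N -> steps_done (i * d + k) i = k.
Proof. by move=> kd; rewrite /steps_done addKn; apply/minn_idPr. Qed.

(** An earlier coordinate is capped at [d] by the minimum, a later one kept at 0 by the truncated
    subtraction. *)
Lemma steps_done_other i i' k : (k < d)%N -> i' != i ->
  steps_done (i * d + k.+1) i' = steps_done (i * d + k) i'.
Proof.
move=> kd; rewrite -val_eqE /= neq_ltn /steps_done => /orP[] lt.
all: have := leq_mul lt (leqnn d); rewrite mulSn; lia.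
Qed.

Lemma steps_done0 i : steps_done 0 i = 0%N.
Proof. by rewrite /steps_done sub0n minn0. Qed.

Lemma steps_done_all i : steps_done (n * d) i = d.
Proof.
by have := leq_mul (ltn_ord i) (leqnn d); rewrite mulSn /steps_done; lia.
Qed.

Lemma eval_table0 l :
  eval_table 0 l = tensor_apply (eval_stage z (fun=> 0%N)) (midx n d D) c l.
Proof.
by apply: tensor_apply_same => i m _; rewrite /eval_stage steps_done0.
Qed.

Lemma eval_table_all l : l \in midx n d D -> eval_table (n * d) l = c l.
Proof.
move=> lS; apply: tensor_apply_id => // i j m jd md.
by rewrite /eval_stage steps_done_all eval_mx_id.
Qed.

Lemma coef_table0 l : l \in midx n d D -> coef_table 0 l = c l.
Proof.
move=> lS; apply: tensor_apply_id => // i j m jd md.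
by rewrite /coef_stage steps_done0 subn0 coef_mx_id.
Qed.

Lemma coef_table_all l :
  coef_table (n * d) l
    = tensor_apply (coef_stage z (fun=> 0%N)) (midx n d D) c l.
Proof.
by apply: tensor_apply_same => i m _; rewrite /coef_stage steps_done_all subnn.
Qed.

Lemma eval_tableS i k l : (k < d)%N -> (k < l i)%N ->
  eval_table (i * d + k.+1) l =
    (eval_table (i * d + k) l - eval_table (i * d + k) (upd l i (inord k)))
      / (node z i (l i) - node z i k).
Proof.
move=> kd kl; set w := _ - node z i k.
rewrite mulrBl ![_ / w]mulrC -mulNr; apply: tensor_apply_upd => [i' m i'i|m md].
  by rewrite /eval_stage steps_done_other.
rewrite /eval_stage !steps_done_cur ?(ltnW kd) //.
rewrite inordK; last by rewrite ltnS ltnW.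
rewrite eval_mxS ?node_neq // ?leq_ord // mulrBl ![_ / _]mulrC -mulNr.
by [].
Qed.

Lemma eval_tableS_id i k l : (k < d)%N -> (l i <= k)%N ->
  eval_table (i * d + k.+1) l = eval_table (i * d + k) l.
Proof.
move=> kd kl; apply: tensor_apply_same => i' m md.
have [->|i'i] := eqVneq i' i.
  by rewrite /eval_stage !steps_done_cur ?(ltnW kd) // eval_mxS_id.
by rewrite /eval_stage steps_done_other.
Qed.

Lemma coef_tableS i r l (x : 'I_d.+1) : (r < d)%N -> (d - r.+1 <= l i)%N ->
  x = (l i).+1 :> nat ->
  coef_table (i * d + r.+1) l = coef_table (i * d + r) l
    - node z i (d - r.+1) * coef_table (i * d + r) (upd l i x).
Proof.
move=> rd kl xE; rewrite -mulNr -[coef_table (_ + r) l]mul1r.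
apply: tensor_apply_upd => [i' m i'i|m md].
  by rewrite /coef_stage steps_done_other.
rewrite /coef_stage !steps_done_cur ?(ltnW rd) // mul1r mulNr xE coef_mxS //.
by rewrite -[(d - r)%N]prednK ?subn_gt0 // -subnS.
Qed.

(** Either row [l i] is still a unit row, or the neighbour would have digit [d + 1] and meets only
    zero entries, or the neighbour leaves the admissible set, where the table is 0. *)
Lemma coef_tableS_id i r l : (r < d)%N ->
    [|| (l i < d - r.+1)%N, l i == ord_max
      | (weight l).+1%:Z > D] ->
  coef_table (i * d + r.+1) l = coef_table (i * d + r) l.
Proof.
move=> rd; have dr : (d - r = (d - r.+1).+1)%N by lia.
have [lt _|ge /=] := ltnP (l i) (d - r.+1).
  apply: tensor_apply_same => i' m md; rewrite /coef_stage.
  have [->|i'i] := eqVneq i' i; last by rewrite steps_done_other.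
  by rewrite !steps_done_cur ?(ltnW rd) // dr coef_mxS_id.
have [lmax _|lmax /= lD] := eqVneq (l i) ord_max.
  apply: tensor_apply_same => i' m md; rewrite /coef_stage.
  have [->|i'i] := eqVneq i' i; last by rewrite steps_done_other.
  rewrite !steps_done_cur ?(ltnW rd) // dr coef_mxS //.
  by rewrite [X in _ - _ * X]coef_mx_tri ?mulr0 ?subr0 // lmax.
have ltd : (l i < d)%N.
  rewrite ltn_neqAle leq_ord andbT; apply: contra lmax => /eqP e.
  exact/eqP/val_inj.
rewrite (@coef_tableS i r l (inord (l i).+1)) ?inordK //.
rewrite [coef_table _ (upd _ _ _)]tensor_apply_upper0.
- by rewrite mulr0 subr0.
- by move=> i' j m; apply: coef_mx_tri.
rewrite in_midx -ltNge; have := weight_upd l i (inord (l i).+1).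
by rewrite inordK // addnS -addSn => /addIn ->.
Qed.

End Tables.

(** * Base expansions and codes of multi-indices *)

Section BaseExpansion.

Variable B : nat.
Hypothesis B_gt0 : (0 < B)%N.

Lemma base_sum_lt (f : nat -> nat) n : (forall i, (f i < B)%N) ->
  (\sum_(i < n) f i * B ^ i < B ^ n)%N.
Proof.
move=> fB; elim: n => [|n IHn]; first by rewrite big_ord0.
rewrite big_ord_recr /= expnS; apply: (@leq_trans (B ^ n + f n * B ^ n)%N).
  by rewrite ltn_add2r.
by rewrite -mulSn leq_mul2r fB orbT.
Qed.

Lemma base_digit (f : nat -> nat) n i : (forall i, (f i < B)%N) -> (i < n)%N ->
  ((\sum_(j < n) f j * B ^ j) %/ B ^ i %% B = f i)%N.
Proof.
move=> fB; elim: n => // n IHn; rewrite ltnS leq_eqVlt big_ord_recr /=.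
have Bi_gt0 j : (0 < B ^ j)%N by rewrite expn_gt0 B_gt0.
case/predU1P => [->|lt].
  by rewrite addnC divnMDl // divn_small ?base_sum_lt // addn0 modn_small.
have -> : (f n * B ^ n = f n * B ^ (n - i.+1) * B * B ^ i)%N.
  by rewrite -!mulnA -expnS -expnD subnK.
by rewrite addnC divnMDl // modnMDl IHn.
Qed.

Lemma base_expansion c n :
  (\sum_(i < n) c %/ B ^ i %% B * B ^ i = c %% B ^ n)%N.
Proof.
elim: n => [|n IHn]; first by rewrite big_ord0 expn0 modn1.
have Bn_gt0 : (0 < B ^ n)%N by rewrite expn_gt0 B_gt0.
rewrite big_ord_recr /= IHn expnSr addnC.
have := divn_eq c (B ^ n * B); rewrite {1}(divn_eq c (B ^ n)).
rewrite {1}(divn_eq (c %/ B ^ n) B).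
rewrite -divnMA mulnDl -mulnA [(B * _)%N]mulnC -addnA => /addnI.
by [].
Qed.

End BaseExpansion.

Section Codes.

Variables n d : nat.
Implicit Types (l : {ffun 'I_n -> 'I_d.+1}) (c : nat).

Definition code l : nat := (\sum_(i < n) l i * d.+1 ^ i)%N.

Definition decode c : {ffun 'I_n -> 'I_d.+1} :=
  [ffun i : 'I_n => inord (c %/ d.+1 ^ i %% d.+1)].

Lemma decodeE c i : decode c i = (c %/ d.+1 ^ i %% d.+1)%N :> nat.
Proof. by rewrite ffunE inordK // ltn_mod. Qed.

Lemma decodeK c : (c < d.+1 ^ n)%N -> code (decode c) = c.
Proof.
move=> cn; rewrite -[RHS](modn_small cn) -base_expansion //.
by apply: eq_bigr => i _; rewrite decodeE.
Qed.

Lemma code_nat_fun l : exists f : nat -> nat,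
  [/\ forall i, (f i < d.+1)%N, forall i : 'I_n, f i = l i
    & code l = (\sum_(i < n) f i * d.+1 ^ i)%N].
Proof.
pose f j : nat := oapp (fun i => l i : nat) 0%N (insub j).
have fE (i : 'I_n) : f i = l i by rewrite /f valK.
exists f; split=> //; last by apply: eq_bigr => i _; rewrite fE.
by move=> i; rewrite /f; case: insub => //= j; apply: ltn_ord.
Qed.

Lemma code_lt l : (code l < d.+1 ^ n)%N.
Proof. by have [f [fB _ ->]] := code_nat_fun l; apply: base_sum_lt. Qed.

Lemma codeK : cancel code decode.
Proof.
move=> l; apply/ffunP => i; apply/val_inj; rewrite /= decodeE.
by have [f [fB fE ->]] := code_nat_fun l; rewrite base_digit // fE.
Qed.

(** Gives the distance in memory between cells that differ in one coordinate; the additive form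
    avoids truncated subtraction. *)
Lemma code_upd l i x :
  (code (upd l i x) + l i * d.+1 ^ i = code l + x * d.+1 ^ i)%N.
Proof.
rewrite /code (bigD1 i) //= [X in (_ = X + _)%N](bigD1 i) //= ffunE eqxx.
rewrite (eq_bigr (fun j => l j * d.+1 ^ j)%N) => [|j /negPf ji].
  by rewrite addnC addnA addnAC.
by rewrite ffunE ji.
Qed.

Lemma sum_codes (g : {ffun 'I_n -> 'I_d.+1} -> nat) :
  (\sum_(c < d.+1 ^ n) g (decode c) = \sum_l g l)%N.
Proof.
rewrite (reindex (fun l => Ordinal (code_lt l))) /=; last first.
  exists (fun c : 'I_(d.+1 ^ n) => decode c) => [l _|c _]; first exact: codeK.
  by apply/val_inj/decodeK.
by apply: eq_bigr => l _; rewrite codeK.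
Qed.

End Codes.
(** * Programs *)

Section WeakestPreconditions.

Variable F : fieldType.
Implicit Types (s t : state F) (Q : nat -> state F -> Prop).

(** Total correctness: a terminating run must exist, and [Q] also receives its operation count. *)
Definition wp (c : prog) s Q : Prop := exists k t, exec c s k t /\ Q k t.

Lemma wp_mono c s Q Q' : (forall k t, Q k t -> Q' k t) -> wp c s Q -> wp c s Q'.
Proof. by move=> QQ' [k [t [ex /QQ' q]]]; exists k, t. Qed.

Lemma wp_skip s Q : Q 0%N s -> wp Skip s Q.
Proof. by move=> q; exists 0%N, s; split=> //; constructor. Qed.

Lemma wp_seq c1 c2 s Q :
  wp c1 s (fun k1 t => wp c2 t (fun k2 u => Q (k1 + k2)%N u)) ->
  wp (Seq c1 c2) s Q.
Proof.
move=> [k1 [t [ex1 [k2 [u [ex2 q]]]]]].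
by exists (k1 + k2)%N, u; split=> //; apply: ESeq ex1 ex2.
Qed.

Lemma wp_iassign x e s Q : Q 0%N (iset s x (ieval (ivar s) e)) ->
  wp (IAssign x e) s Q.
Proof. by move=> q; exists 0%N; eexists; split; [constructor|]. Qed.

Lemma wp_fmove r r1 s Q : Q 0%N (fset s r (fget s r1)) -> wp (FMove r r1) s Q.
Proof. by move=> q; exists 0%N; eexists; split; [constructor|]. Qed.

Lemma wp_fop r o r1 r2 s Q : (o = FDiv -> fget s r2 != 0) ->
  Q 1%N (fset s r (feval o (fget s r1) (fget s r2))) -> wp (FOp r o r1 r2) s Q.
Proof. by move=> nz q; exists 1%N; eexists; split; [constructor|]. Qed.

Lemma wp_ifle e1 e2 c1 c2 s Q :
  (ieval (ivar s) e1 <= ieval (ivar s) e2 -> wp c1 s Q) ->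
  (ieval (ivar s) e2 < ieval (ivar s) e1 -> wp c2 s Q) ->
  wp (IfLe e1 e2 c1 c2) s Q.
Proof.
move=> wp1 wp2.
have [k [t [ex q]]] :
    wp (if ieval (ivar s) e1 <= ieval (ivar s) e2 then c1 else c2) s Q.
  by case: leP.
by exists k, t; split=> //; constructor.
Qed.

(** The loop runs exactly [N] times; [I j k t] describes the state after [j] rounds and [k]
    operations. Induction is on the rounds left. *)
Lemma wp_for N e1 e2 c s (I : nat -> nat -> state F -> Prop) Q :
    I 0%N 0%N s ->
    (forall j k t, (j < N)%N -> I j k t ->
      ieval (ivar t) e1 <= ieval (ivar t) e2
      /\ wp c t (fun k' u => I j.+1 (k + k')%N u)) ->
    (forall k t, I N k t ->
      ieval (ivar t) e2 < ieval (ivar t) e1 /\ Q k t) ->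
  wp (WhileLe e1 e2 c) s Q.
Proof.
move=> I0 Istep Iend.
suff main m : forall j k t, (j + m = N)%N -> I j k t ->
    wp (WhileLe e1 e2 c) t (fun k' u => Q (k + k')%N u).
  exact: (main N 0%N 0%N s).
elim: m => [|m IHm] j k t.
  rewrite addn0 => -> /Iend[lt q]; exists 0%N, t; rewrite addn0; split=> //.
  by apply: EWhileLe; rewrite leNgt lt /=; constructor.
move=> jm Ij; have [|le [k1 [u [ex1 Iu]]]] := Istep j k t _ Ij; first by lia.
have [|k2 [v [ex2 q]]] := IHm j.+1 _ u _ Iu; first by lia.
exists (k1 + k2)%N, v; rewrite addnA; split=> //.
by apply: EWhileLe; rewrite le; apply: ESeq ex1 ex2.
Qed.

End WeakestPreconditions.

Local Notation "c1 ;; c2" := (Seq c1 c2) (at level 60, right associativity).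
Local Notation lit k := (ILit k%Z).

(* Integer variables: 3 is N = (d + 1)^n, 4 the loop counter, 5 the code of the
   current multi-index, 6 the current stage, 7 the last power of d + 1, 8 the
   last sum of digits, 9 the current coordinate, 10 an inner loop counter, 11
   the index of the current node, 12 the current digit, 13 and 14 the addresses
   in array 2 of the current cell at this stage and at the previous one, 15 the
   weight of the current multi-index. *)
Definition base : iexp := IAdd (IVar 1) (lit 1).

(** With [e] the value of variable [x], one loop yields both [(d + 1)^e], the stride of coordinate
    [e], and the sum of the [e] lowest digits, which is the weight for [e = n]. *)
Definition digits (x : nat) : prog :=
  IAssign 10 (lit 0);; IAssign 7 (lit 1);; IAssign 8 (lit 0);;
  WhileLe (IAdd (IVar 10) (lit 1)) (IVar x)
    (IAssign 8 (IAdd (IVar 8) (IMod (IDiv (IVar 5) (IVar 7)) base));;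
     IAssign 7 (IMul (IVar 7) base);;
     IAssign 10 (IAdd (IVar 10) (lit 1))).

(** Stage [u + 1] makes step [u], hence the subtraction of 1. The neighbour with digit [k] lies
    [(l_i - k) * (d + 1)^i] addresses lower; array 3 is scratch. *)
Definition eval_step : prog :=
  IAssign 9 (IDiv (ISub (IVar 6) (lit 1)) (IVar 1));;
  IAssign 11 (IMod (ISub (IVar 6) (lit 1)) (IVar 1));;
  digits 9;;
  IAssign 12 (IMod (IDiv (IVar 5) (IVar 7)) base);;
  IfLe (IAdd (IVar 11) (lit 1)) (IVar 12)
    (FOp (3%N, lit 0) FSub (2%N, IVar 14)
       (2%N, ISub (IVar 14) (IMul (ISub (IVar 12) (IVar 11)) (IVar 7)));;
     FOp (3%N, lit 1) FSub (0%N, IAdd (IMul (IVar 9) base) (IVar 12))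
       (0%N, IAdd (IMul (IVar 9) base) (IVar 11));;
     FOp (2%N, IVar 13) FDiv (3%N, lit 0) (3%N, lit 1))
    (FMove (2%N, IVar 13) (2%N, IVar 14)).

(** The nested tests detect the three cases of [coef_tableS_id], where the cell is copied at no
    cost. *)
Definition coef_step : prog :=
  IAssign 9
    (IDiv (ISub (ISub (IVar 6) (lit 1)) (IMul (IVar 0) (IVar 1))) (IVar 1));;
  IAssign 11 (ISub (ISub (IVar 1) (lit 1))
    (IMod (ISub (ISub (IVar 6) (lit 1)) (IMul (IVar 0) (IVar 1))) (IVar 1)));;
  digits 9;;
  IAssign 12 (IMod (IDiv (IVar 5) (IVar 7)) base);;
  IfLe (IVar 11) (IVar 12)
    (IfLe (IAdd (IVar 12) (lit 1)) (IVar 1)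
      (IfLe (IAdd (IVar 15) (lit 1)) (IVar 2)
        (FOp (3%N, lit 0) FMul (0%N, IAdd (IMul (IVar 9) base) (IVar 11))
           (2%N, IAdd (IVar 14) (IVar 7));;
         FOp (2%N, IVar 13) FSub (2%N, IVar 14) (3%N, lit 0))
        (FMove (2%N, IVar 13) (2%N, IVar 14)))
      (FMove (2%N, IVar 13) (2%N, IVar 14)))
    (FMove (2%N, IVar 13) (2%N, IVar 14)).

Definition stages : iexp := IMul (lit 2) (IMul (IVar 0) (IVar 1)).

(** Division of a single counter by [N] yields the stage and the code. Stage 0 copies the input,
    also outside the admissible set, since moves are free. *)
Definition update_cell : prog :=
  IAssign 6 (IDiv (IVar 4) (IVar 3));;
  IAssign 5 (IMod (IVar 4) (IVar 3));;
  IAssign 13 (IAdd (IMul (ISub stages (IVar 6)) (IVar 3)) (IVar 5));;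
  IAssign 14 (IAdd (IVar 13) (IVar 3));;
  IfLe (IVar 6) (lit 0) (FMove (2%N, IVar 13) (1%N, IVar 5))
    (digits 0;;
     IAssign 15 (IVar 8);;
     IfLe (IVar 15) (IVar 2)
       (IfLe (IVar 6) (IMul (IVar 0) (IVar 1)) eval_step coef_step)
       Skip);;
  IAssign 4 (IAdd (IVar 4) (lit 1)).

Definition interpolation_prog : prog :=
  digits 0;;
  IAssign 3 (IVar 7);;
  IAssign 4 (lit 0);;
  WhileLe (IAdd (IVar 4) (lit 1)) (IMul (IAdd stages (lit 1)) (IVar 3))
    update_cell.

(** * Correctness and operation count of the program *)

Section Correctness.

Variables (F : fieldType) (n d : nat).
Implicit Types (s t : state F) (Q : nat -> state F -> Prop).

(** The clause on variable 8 is conditional because the first call finds arbitrary contents in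
    variable 5. *)
Lemma wp_digits (x e : nat) s Q : x \notin [:: 7; 8; 10]%N ->
    ivar s x = e%:Z -> ivar s 1%N = d%:Z ->
    (forall t, farr t = farr s ->
      (forall y, y \notin [:: 7; 8; 10]%N -> ivar t y = ivar s y) ->
      ivar t 7%N = (d.+1 ^ e)%N%:Z ->
      (forall c : nat, ivar s 5%N = c%:Z ->
        ivar t 8%N = (\sum_(i < e) c %/ d.+1 ^ i %% d.+1)%N%:Z) ->
      Q 0%N t) ->
  wp (digits x) s Q.
Proof.
move=> xP sx s1 QP; do 3![apply/wp_seq/wp_iassign].
apply: (wp_for (N := e) (I := fun j k t => [/\ k = 0%N, farr t = farr s,
  forall y, y \notin [:: 7; 8; 10]%N -> ivar t y = ivar s y,
  ivar t 10%N = j%:Z & ivar t 7%N = (d.+1 ^ j)%N%:Z /\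
  (forall c : nat, ivar s 5%N = c%:Z ->
        ivar t 8%N = (\sum_(i < j) c %/ d.+1 ^ i %% d.+1)%N%:Z)])).
- split=> //=.
  + by move=> y; rewrite !inE !negb_or => /and3P[/negPf-> /negPf-> /negPf->].
  + by split=> // c _; rewrite big_ord0.
- move=> j k t je [-> Ef Ev E10 [E7 E8]]; split.
    by rewrite /= E10 Ev // sx; lia.
  do 2![apply/wp_seq/wp_iassign]; apply: wp_iassign; split=> //=.
  + move=> y yP; have := yP; rewrite !inE !negb_or.
    case/and3P=> [/negPf-> /negPf-> /negPf->].
    exact: Ev.
  + by rewrite E10; lia.
  + rewrite E7 Ev // s1; split=> [|c c5]; first by rewrite expnSr; lia.
    rewrite (E8 c) // Ev // c5 -[d%:Z + 1]/(d%:Z + 1%:Z) -PoszD addn1.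
    by rewrite divz_nat modz_nat -PoszD big_ord_recr.
- move=> k t [-> Ef Ev E10 [E7 E8]]; split; last exact: QP.
  by rewrite /= E10 Ev // sx; lia.
Qed.

Definition writes s t (A : int) (v : F) : Prop :=
  [/\ forall x, (x <= 4)%N -> ivar t x = ivar s x,
      forall x (j : int), (x <= 1)%N -> farr t (x, j) = farr s (x, j),
      forall j : int, j != A -> farr t (2%N, j) = farr s (2%N, j)
    & farr t (2%N, A) = v].

Lemma digit_code (l : {ffun 'I_n -> 'I_d.+1}) (i : 'I_n) :
  (code l %/ d.+1 ^ i %% d.+1)%N = l i.
Proof. by rewrite -decodeE codeK. Qed.

Lemma writes_fset s t (A : int) v v' : ivar t 13%N = A ->
    (forall x, (x <= 4)%N -> ivar t x = ivar s x) ->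
    (forall x (j : int), (x <= 2)%N -> farr t (x, j) = farr s (x, j)) ->
    v = v' ->
  writes s (fset t (2%N, IVar 13) v) A v'.
Proof.
move=> t13 tv ta <-; split=> [x x4|x j x1|j jA|] /=.
- exact: tv.
- by rewrite /faddr xpair_eqE /= (ltn_eqF (x1 : (x < 2)%N)) /= ta // ltnW.
- by rewrite /faddr xpair_eqE /= t13 (negPf jA) ta.
- by rewrite /faddr xpair_eqE /= t13 eqxx.
Qed.

Variables (D : int) (z : 'I_n -> 'I_d.+1 -> F).
Variable c : {ffun 'I_n -> 'I_d.+1} -> F.
Hypotheses (d_gt0 : (0 < d)%N) (z_inj : forall i, injective (z i)).

Definition grid_loaded s : Prop := forall (i : 'I_n) (j : 'I_d.+1),
  farr s (0%N, ((i * d.+1 + j)%N)%:Z) = z i j.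

Lemma grid_loaded_node s (i : 'I_n) (j : nat) : grid_loaded s -> (j <= d)%N ->
  farr s (0%N, i%:Z * (d%:Z + 1%Z) + j%:Z) = node z i j.
Proof.
move=> sz jd; rewrite -[j in LHS](@inordK d) // /node -sz.
congr (farr s (_, _)).
by rewrite PoszD PoszM; congr (_ * _ + _); lia.
Qed.

Lemma divn_lt_ord u : (u < n * d)%N -> (u %/ d < n)%N.
Proof. by move=> und; rewrite ltn_divLR. Qed.

Lemma wp_eval_step s (u P0 : nat) (l : {ffun 'I_n -> 'I_d.+1}) (A : int) :
    ivar s 1%N = d%:Z -> ivar s 5%N = (code l)%:Z -> ivar s 6%N = u.+1%:Z ->
    ivar s 13%N = A -> ivar s 14%N = (P0 + code l)%N%:Z ->
    grid_loaded s -> (u < n * d)%N -> l \in midx n d D ->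
    {in midx n d D, forall l',
      farr s (2%N, (P0 + code l')%N%:Z) = eval_table D z c u l'} ->
  wp eval_step s (fun k t =>
    (k <= 3)%N /\ writes s t A (eval_table D z c u.+1 l)).
Proof.
move=> s1 s5 s6 s13 s14 sz und lS prev.
pose i := Ordinal (divn_lt_ord und); pose k := (u %% d)%N.
have kd : (k < d)%N by rewrite ltn_mod.
have uE : u = (i * d + k)%N by rewrite /= -divn_eq.
have u1E : u.+1 = (i * d + k.+1)%N by rewrite addnS -uE.
do 2![apply/wp_seq/wp_iassign]; rewrite /= s1 s6.
have -> : u.+1%:Z - 1 = u%:Z by lia.
rewrite divz_nat modz_nat -/k -[(u %/ d)%N]/(i : nat).
apply/wp_seq/(@wp_digits 9 i) => // t Ef Ev t7 _.
have t5 : ivar t 5%N = (code l)%:Z by rewrite Ev.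
have t1 : ivar t 1%N = d%:Z by rewrite Ev.
have t9 : ivar t 9%N = i%:Z by rewrite Ev.
have t11 : ivar t 11%N = k%:Z by rewrite Ev.
have t13 : ivar t 13%N = A by rewrite Ev.
have t14 : ivar t 14%N = (P0 + code l)%N%:Z by rewrite Ev.
have t04 x : (x <= 4)%N -> ivar t x = ivar s x.
  by move=> x4; rewrite Ev; do 5?[case: x x4 => // x x4].
have tz : grid_loaded t by move=> ? ?; rewrite Ef; apply: sz.
apply/wp_seq/wp_iassign; rewrite /= t5 t7 t1.
rewrite -[d%:Z + 1]/(d%:Z + 1%:Z) -PoszD addn1 divz_nat modz_nat digit_code.
apply: wp_ifle; rewrite /= t11 => kl.
  have {kl} kl : (k < l i)%N by lia.
  (* Lowering a digit lowers the weight, so the neighbour is admissible and its previous value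
     available. *)
  have ldS : upd l i (inord k) \in midx n d D.
    move: lS; rewrite !in_midx; have := weight_upd l i (inord k).
    by rewrite inordK; lia.
  have addrE : (P0 + code l)%N%:Z - ((l i)%:Z - k%:Z) * (d.+1 ^ i)%N%:Z
      = (P0 + code (upd l i (inord k)))%N%:Z.
    have := code_upd l i (inord k); rewrite inordK; last by lia.
    move: (d.+1 ^ i)%N (code _) => w cu; rewrite !PoszD; move/(congr1 Posz).
    by rewrite !PoszD !PoszM; nia.
  apply/wp_seq/wp_fop => //; apply/wp_seq/wp_fop => //; apply: wp_fop.
    (* The divisor is a difference of distinct nodes, so the division is not stuck. *)
    move=> _; rewrite /fget /faddr /= t9 t1 t11.
    rewrite !grid_loaded_node ?(ltnW kd) ?leq_ord //.
    by rewrite subr_eq0 node_neq ?leq_ord.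
  rewrite /fget /faddr /= t9 t1 t11 t14 t7 addrE.
  rewrite !grid_loaded_node ?(ltnW kd) ?leq_ord //.
  split=> //; apply: writes_fset => //= [x x4|x j x2|].
  - by rewrite ltn_eqF ?t04 //; apply: leq_ltn_trans x4 _.
  - by rewrite !xpair_eqE ltn_eqF // Ef.
  - by rewrite u1E eval_tableS // -uE -!prev // Ef.
apply: wp_fmove; split=> //; apply: writes_fset => //= [x x4|x j x2|].
- by rewrite ltn_eqF ?t04 //; apply: leq_ltn_trans x4 _.
- by rewrite Ef.
rewrite /fget /faddr /= t14 Ef /= prev // u1E eval_tableS_id ?uE //; lia.
Qed.

Lemma wp_coef_step s (u P0 : nat) (l : {ffun 'I_n -> 'I_d.+1}) (A : int) :
    ivar s 0%N = n%:Z -> ivar s 1%N = d%:Z -> ivar s 2%N = D ->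
    ivar s 5%N = (code l)%:Z -> ivar s 6%N = (n * d + u).+1%:Z ->
    ivar s 13%N = A -> ivar s 14%N = (P0 + code l)%N%:Z ->
    ivar s 15%N = (weight l)%:Z ->
    grid_loaded s -> (u < n * d)%N -> l \in midx n d D ->
    {in midx n d D, forall l',
      farr s (2%N, (P0 + code l')%N%:Z) = coef_table D z c u l'} ->
  wp coef_step s (fun k t =>
    (k <= 3)%N /\ writes s t A (coef_table D z c u.+1 l)).
Proof.
move=> s0 s1 s2 s5 s6 s13 s14 s15 sz und lS prev.
pose i := Ordinal (divn_lt_ord und); pose r := (u %% d)%N.
have rd : (r < d)%N by rewrite ltn_mod.
have uE : u = (i * d + r)%N by rewrite /= -divn_eq.
have u1E : u.+1 = (i * d + r.+1)%N by rewrite addnS -uE.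
do 2![apply/wp_seq/wp_iassign]; rewrite /= s0 s1 s6.
have -> : (n * d + u).+1%:Z - 1 - n%:Z * d%:Z = u%:Z by lia.
rewrite divz_nat modz_nat -/r -[(u %/ d)%N]/(i : nat).
have -> : d%:Z - 1 - r%:Z = (d - r.+1)%N%:Z by lia.
apply/wp_seq/(@wp_digits 9 i) => // t Ef Ev t7 _.
have t5 : ivar t 5%N = (code l)%:Z by rewrite Ev.
have t1 : ivar t 1%N = d%:Z by rewrite Ev.
have t2 : ivar t 2%N = D by rewrite Ev.
have t9 : ivar t 9%N = i%:Z by rewrite Ev.
have t11 : ivar t 11%N = (d - r.+1)%N%:Z by rewrite Ev.
have t13 : ivar t 13%N = A by rewrite Ev.
have t14 : ivar t 14%N = (P0 + code l)%N%:Z by rewrite Ev.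
have t15 : ivar t 15%N = (weight l)%:Z by rewrite Ev.
have t04 x : (x <= 4)%N -> ivar t x = ivar s x.
  by move=> x4; rewrite Ev; do 5?[case: x x4 => // x x4].
have tz : grid_loaded t by move=> ? ?; rewrite Ef; apply: sz.
apply/wp_seq/wp_iassign; rewrite /= t5 t7 t1.
rewrite -[d%:Z + 1]/(d%:Z + 1%:Z) -PoszD addn1 divz_nat modz_nat digit_code.
have move_cell k0 :
    [|| (l i < d - r.+1)%N, l i == ord_max | (weight l).+1%:Z > D] ->
    k0 = 0%N ->
  wp (FMove (2%N, IVar 13) (2%N, IVar 14)) (iset t 12 (l i)) (fun k t0 =>
     (k0 + k <= 3)%N /\ writes s t0 A (coef_table D z c u.+1 l)).
  move=> skip ->; apply: wp_fmove; split=> //.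
  apply: writes_fset => //= [x x4|x j x2|].
  - by rewrite ltn_eqF ?t04 //; apply: leq_ltn_trans x4 _.
  - by rewrite Ef.
  by rewrite /fget /faddr /= t14 Ef /= prev // u1E coef_tableS_id ?uE.
apply: wp_ifle; rewrite /= t11 => kl; last by apply: move_cell => //; lia.
apply: wp_ifle; rewrite /= t1 => ld; last first.
  apply: move_cell => //; apply/or3P/Or32/eqP/val_inj => /=.
  have := leq_ord (l i); lia.
apply: wp_ifle; rewrite /= t15 t2 => lD; last first.
  by apply: move_cell => //; apply/or3P/Or33; lia.
have {}ld : (l i < d)%N by lia.
pose x : 'I_d.+1 := inord (l i).+1.
have xE : x = (l i).+1 :> nat by rewrite inordK.
(* The third test guarantees that the raised neighbour is admissible. *)
have ldS : upd l i x \in midx n d D.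
  rewrite in_midx; have := weight_upd l i x; rewrite xE; lia.
have addrE : (P0 + code l)%N%:Z + (d.+1 ^ i)%N%:Z
    = (P0 + code (upd l i x))%N%:Z.
  by have := code_upd l i x; rewrite xE mulSn; lia.
apply/wp_seq/wp_fop => //; apply/wp_fop => //.
rewrite /fget /faddr /= t9 t1 t11 t14 t7 addrE grid_loaded_node ?leq_subr //.
split=> //; apply: writes_fset => //= [y y4|y j y2|].
- by rewrite ltn_eqF ?t04 //; apply: leq_ltn_trans y4 _.
- by rewrite !xpair_eqE ltn_eqF // Ef.
rewrite u1E (@coef_tableS _ _ _ _ _ _ _ _ _ x) // -?uE.
by rewrite -!prev // Ef.
Qed.

Definition table (t : nat) : {ffun 'I_n -> 'I_d.+1} -> F :=
  if (t <= n * d)%N then eval_table D z c t else coef_table D z c (t - n * d).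

Lemma eval_table_table (t : nat) l :
  (t <= n * d)%N -> eval_table D z c t l = table t l.
Proof. by rewrite /table => ->. Qed.

(** At the junction both families hold the Newton coefficients, so stage [n * d] is the last
    elimination table and the first Horner table. *)
Lemma coef_table_table (t : nat) l : l \in midx n d D ->
  coef_table D z c t l = table (n * d + t) l.
Proof.
move=> lS; rewrite /table; case: t => [|t].
  by rewrite addn0 leqnn coef_table0 // eval_table_all.
by rewrite addnS ltnNge leq_addr /= -addnS addKn.
Qed.

Local Notation N := (d.+1 ^ n)%N.
Local Notation T := (2 * (n * d))%N.

(* The last stage is stored first, so that it ends up where the output is
   expected. *)
Definition cell (t m : nat) : int := ((T - t) * N + m)%N%:Z.

Definition ivars_ok s (q : nat) : Prop :=
  [/\ ivar s 0%N = n%:Z, ivar s 1%N = d%:Z, ivar s 2%N = D, ivar s 3%N = N%:Z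
    & ivar s 4%N = q%:Z].

(** The membership of [l] enters the cost bound as a factor 0 or 1, so that a sum over all codes
    counts only admissible cells. *)
Lemma wp_update_cell s (t m : nat) (l : {ffun 'I_n -> 'I_d.+1}) :
    ivars_ok s (t * N + m) -> (t <= T)%N -> (m < N)%N -> decode n d m = l ->
    grid_loaded s ->
    (l \in midx n d D -> farr s (1%N, (code l)%:Z) = table 0 l) ->
    (forall t' : nat, t = t'.+1 ->
      {in midx n d D,
        forall l', farr s (2%N, cell t' (code l')) = table t' l'}) ->
  wp update_cell s (fun k s' => [/\ (k <= 3 * (l \in midx n d D))%N,
    ivars_ok s' (t * N + m).+1,
    forall x (j : int), (x <= 1)%N -> farr s' (x, j) = farr s (x, j),
    forall j : int, j != cell t m -> farr s' (2%N, j) = farr s (2%N, j)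
    & l \in midx n d D -> farr s' (2%N, cell t m) = table t l]).
Proof.
move=> [s0 s1 s2 s3 s4] tT mN ml sz sa prev.
have lm : code l = m by rewrite -ml decodeK.
have N_gt0 : (0 < N)%N by rewrite expn_gt0.
do 2![apply/wp_seq/wp_iassign]; rewrite /= s3 s4.
rewrite divz_nat modz_nat divnMDl // divn_small // addn0 modnMDl modn_small //.
do 2![apply/wp_seq/wp_iassign]; rewrite /= s3 s0 s1.
have -> : (2%:Z * (n%:Z * d%:Z) - t%:Z) * N%:Z + m%:Z = cell t m.
  by rewrite /cell !(PoszD, PoszM) -subzn // !PoszM.
set s1' := iset _ 14 _.
have [s1'0 s1'1 s1'2 s1'3 s1'4] : ivars_ok s1' (t * N + m) by [].
have s1'5 : ivar s1' 5%N = m%:Z by [].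
have s1'6 : ivar s1' 6%N = t%:Z by [].
have s1'13 : ivar s1' 13%N = cell t m by [].
have s1'14 : ivar s1' 14%N = cell t m + N%:Z by [].
have s1'f : farr s1' = farr s by [].
clearbody s1'.
apply/wp_seq/wp_ifle; rewrite /= s1'6 => t0.
  have {t0} t0 : t = 0%N by lia.
  apply: wp_fmove; apply: wp_iassign; split=> //=.
  - by split; rewrite //= s1'4; lia.
  - move=> x j x1.
    by rewrite /faddr xpair_eqE /= (ltn_eqF (x1 : (x < 2)%N)) /= s1'f.
  - by move=> j jm; rewrite /faddr xpair_eqE /= s1'13 (negPf jm) s1'f.
  - move=> lS; rewrite /faddr xpair_eqE /= s1'13 eqxx.
    by rewrite /fget /faddr /= s1'5 s1'f -lm sa // t0.
case: t t0 tT {s4} s1'4 s1'6 s1'13 s1'14 prev => //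
  u _ uT s1'4 s1'6 s1'13 s1'14 prev.
apply/wp_seq/(@wp_digits 0 n) => // s' Ef Ev _ E8.
apply/wp_seq/wp_iassign.
have s'8 : ivar s' 8%N = (weight l)%:Z.
  rewrite (E8 m) // /weight; congr Posz; apply: eq_bigr => i _.
  by rewrite -ml decodeE.
rewrite [ieval _ _]/= s'8; set s2' := iset _ 15 _.
have [s2'0 s2'1 s2'2 s2'3 s2'4] : ivars_ok s2' (u.+1 * N + m).
  by split; rewrite /= Ev.
have s2'5 : ivar s2' 5%N = (code l)%:Z by rewrite lm /= Ev.
have s2'6 : ivar s2' 6%N = u.+1%:Z by rewrite /= Ev.
have s2'13 : ivar s2' 13%N = cell u.+1 m by rewrite /= Ev.
(* Stages are stored backwards: the previous table starts [N] addresses further up. *)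
have s2'14 : ivar s2' 14%N = ((T - u) * N + code l)%N%:Z.
  rewrite /= Ev // s1'14 lm /cell -PoszD addnAC -mulSnr; congr (_ * _ + _)%N%:Z.
  by lia.
have s2'15 : ivar s2' 15%N = (weight l)%:Z by [].
have s2'f : farr s2' = farr s by rewrite /= Ef.
clearbody s2'.
have step_ok (k : nat) s3' v : (k <= 3)%N /\ writes s2' s3' (cell u.+1 m) v ->
    l \in midx n d D -> v = table u.+1 l ->
  wp (IAssign 4 (IAdd (IVar 4) (lit 1))) s3' (fun k2 s4' =>
    [/\ (k + k2 <= 3 * (l \in midx n d D))%N,
    ivars_ok s4' (u.+1 * N + m).+1,
    forall x (j : int), (x <= 1)%N -> farr s4' (x, j) = farr s (x, j),
    forall j : int, j != cell u.+1 m -> farr s4' (2%N, j) = farr s (2%N, j)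
    & l \in midx n d D -> farr s4' (2%N, cell u.+1 m) = table u.+1 l]).
  move=> [k3 [Wv W1 W2 Wr]] lS vE; apply: wp_iassign; split=> //=.
  - by rewrite lS addn0.
  - by split; rewrite /= Wv // ?s2'4; lia.
  - by move=> x j x1; rewrite W1 // s2'f.
  - by move=> j jm; rewrite W2 // s2'f.
  - by rewrite Wr.
have sz2 : grid_loaded s2' by move=> ? ?; rewrite s2'f; apply: sz.
apply: wp_ifle; rewrite /= s2'15 s2'2 => lD.
  have lS : l \in midx n d D by rewrite in_midx.
  apply: wp_ifle; rewrite /= s2'6 s2'0 s2'1 => und.
    have {}und : (u < n * d)%N by lia.
    apply: wp_mono
      (@wp_eval_step s2' u _ l _ s2'1 s2'5 s2'6 s2'13 s2'14 sz2 und lS _).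
      by move=> k s3' H; apply: (step_ok _ _ _ H lS); apply: eval_table_table.
    by move=> l' l'S; rewrite s2'f eval_table_table ?(ltnW und) // -prev.
  have {}und : (n * d <= u)%N by lia.
  have uE := subnKC und; have vT : (u - n * d < n * d)%N by lia.
  rewrite -uE in s2'6.
  apply: wp_mono (@wp_coef_step s2' _ _ l _ s2'0 s2'1 s2'2 s2'5 s2'6 s2'13
    s2'14 s2'15 sz2 vT lS _).
    move=> k s3' H; apply: (step_ok _ _ _ H lS).
    by rewrite coef_table_table // addnS uE.
  by move=> l' l'S; rewrite s2'f coef_table_table // uE -prev.
have lS : l \notin midx n d D by rewrite in_midx -ltNge.
apply: wp_skip; apply: wp_iassign; split=> //=.
- by split; rewrite //= s2'4; lia.
- by move=> x j x1; rewrite s2'f.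
- by rewrite s2'f.
- by rewrite (negPf lS).
Qed.

(** Every stage scans the same codes, so the total cost is that of one scan times the number of
    stages. *)
Lemma sum_mod (g : nat -> nat) (M r : nat) :
  (\sum_(q < r * M) g (q %% M) = r * \sum_(m < M) g m)%N.
Proof.
elim: r => [|r IHr]; first by rewrite big_ord0.
rewrite !mulSn big_split_ord /= -IHr; congr (_ + _)%N; apply: eq_bigr => q _.
  by rewrite modn_small.
by rewrite modnDl.
Qed.

Lemma sum_decode_midx :
  (\sum_(m < N) (decode n d m \in midx n d D) = #|midx n d D|)%N.
Proof.
rewrite (sum_codes (fun l => l \in midx n d D : nat)) -sum1_card.
by rewrite [RHS]big_mkcond; apply: eq_bigr => l _; case: (l \in _).
Qed.

(** Division by [N] recovers the pair. Hence no write destroys an earlier result. *)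
Lemma cell_inj (t t' m m' : nat) : (t <= T)%N -> (t' <= T)%N ->
  (m < N)%N -> (m' < N)%N -> cell t m = cell t' m' -> t = t' /\ m = m'.
Proof.
move=> tT t'T mN m'N [e].
have N_gt0 : (0 < N)%N by rewrite expn_gt0.
have mE := congr1 (modn^~ N) e; rewrite /= !modnMDl !modn_small // in mE.
have tE := congr1 (divn^~ N) e; rewrite /= !divnMDl // !divn_small // in tE.
by split=> //; lia.
Qed.

Lemma wp_interpolation_prog (a : {ffun 'I_n -> 'I_d.+1} -> F) s :
    input_state D z a s -> {in midx n d D, table 0 =1 a} ->
  wp interpolation_prog s (fun k t =>
    (k <= 3 * (T.+1 * #|midx n d D|))%N
    /\ {in midx n d D, forall l, farr t (2%N, midx_code l) = table T l}).
Proof.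
move=> [[s0 s1 s2] sz sa] a0.
have N_gt0 : (0 < N)%N by rewrite expn_gt0.
apply/wp_seq/(@wp_digits 0 n) => // s' Ef Ev E7 _.
do 2![apply/wp_seq/wp_iassign].
(* The scan is lexicographic in stage and code, so after [q] rounds the admissible pairs with
   [r * N + code l < q] are filled in. *)
pose I q k t := [/\
  (k <= 3 * \sum_(q' < q) (decode n d (q' %% N) \in midx n d D))%N,
  ivars_ok t q, forall x (j : int), (x <= 1)%N -> farr t (x, j) = farr s (x, j)
  & forall r l, (r <= T)%N -> l \in midx n d D -> (r * N + code l < q)%N ->
      farr t (2%N, cell r (code l)) = table r l].
apply: (wp_for (N := (T.+1 * N)%N) (I := I)).
- split=> //.
    by split; rewrite /= ?E7 ?Ev.
  by move=> x j _; rewrite /= Ef.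
- move=> q k t qT [kq tv ta t2].
  have [t_0 t_1 _ t_3 t_4] := tv.
  split; first by rewrite /= t_4 t_0 t_1 t_3; lia.
  have rT : (q %/ N <= T)%N by rewrite -ltnS ltn_divLR.
  have mN : (q %% N < N)%N by rewrite ltn_mod.
  rewrite {1}(divn_eq q N) in tv.
  have tz : grid_loaded t by move=> i j; rewrite ta.
  apply: wp_mono (wp_update_cell tv rT mN erefl tz _ _).
  + move=> k' t' [k'q t'v t'a t'2 t'r]; split.
    * by rewrite big_ord_recr mulnDr leq_add.
    * by rewrite -divn_eq in t'v.
    * by move=> x j x1; rewrite t'a ?ta.
    * move=> r l rT' lS; rewrite ltnS leq_eqVlt => /predU1P[qE|qlt].
        have -> : code l = (q %% N)%N.
          by rewrite -qE modnMDl modn_small ?code_lt.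
        have -> : r = (q %/ N)%N.
          by rewrite -qE divnMDl // divn_small ?addn0 ?code_lt.
        rewrite t'r; last first.
          by rewrite -qE modnMDl modn_small ?code_lt ?codeK.
        by rewrite -qE modnMDl modn_small ?code_lt ?codeK.
      rewrite t'2 ?t2 //; apply: contraTneq qlt => /cell_inj[||||rE cE] //.
        exact: code_lt.
      by rewrite rE cE -divn_eq ltnn.
  + by move=> lS; rewrite ta // a0 //; apply: sa.
  + move=> r' rE l lS; apply: t2 => //; first by rewrite (leq_trans _ rT) ?rE.
    rewrite (divn_eq q N) rE mulSn -addnA addnCA ltn_add2l addnC.
    by rewrite ltn_addl ?code_lt.
- move=> k t [kT [t0 t1 _ t3 t4] _ tr]; split.
    by rewrite /= t4 t0 t1 t3; lia.
  split; last first.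
    (* Stage [T] has offset 0, the place where the output is expected. *)
    move=> l lS; rewrite -(tr T l) //;
      rewrite ?mulSn ?[(N + _)%N]addnC ?ltn_add2l ?code_lt //.
    by rewrite /cell subnn mul0n add0n.
  rewrite (sum_mod (fun m => decode n d m \in midx n d D)) in kT.
  by rewrite sum_decode_midx in kT.
Qed.

End Correctness.

Theorem mainTheorem2 :
  (forall (F : fieldType) (n d : nat) (D : int)
      (z : 'I_n -> 'I_d.+1 -> F) (a : {ffun 'I_n -> 'I_d.+1} -> F),
    (1 <= d)%N -> (forall i, injective (z i)) ->
    exists! P : {mpoly F[n]}, interpolates D z a P) /\
  (exists (c : prog) (p : {mpoly int[2]}),
    forall (F : fieldType) (n d : nat) (D : int)
      (z : 'I_n -> 'I_d.+1 -> F) (a : {ffun 'I_n -> 'I_d.+1} -> F)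
      (P : {mpoly F[n]}) (s : state F),
    (1 <= d)%N -> (forall i, injective (z i)) ->
    interpolates D z a P -> input_state D z a s ->
    exists (k : nat) (t : state F),
      [/\ exec c s k t, output_state d D P t &
          k%:Z <= #|midx n d D|%:Z * eval2 p n d]).
Proof.
split=> [F n d D z a _ z_inj|]; first exact: interpolates_unique.
(* Three operations per admissible cell in each of [2 * n * d + 1] stages; the initial copy is
   charged at the same rate. *)
exists interpolation_prog, (3%:R * (2%:R * ('X_0 * 'X_1) + 1)).
move=> F n d D z a P s d_gt0 z_inj PP sP.
(* The Newton coefficients of [P] occur in the proof only: they define the tables that the program
   computes from [a]. *)
have [c [cP ca]] := interpolates_newton PP.
have a0 : {in midx n d D, table D z c 0 =1 a}.
  by move=> l lS; rewrite /table leq0n eval_table0 ca.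
have [k [t [ex [kT tP]]]] := wp_interpolation_prog d_gt0 z_inj sP a0.
exists k, t; split=> // [l lS|].
  (* The final table is the last Horner table, which holds the coefficients of [P]. *)
  rewrite tP // mul2n -addnn -coef_table_table // coef_table_all.
  exact: cP.
rewrite /eval2 !(mevalM, mevalD, mevalXU, rmorph_nat, rmorph1) /=.
move: kT; rewrite -lez_nat => /le_trans; apply.
rewrite le_eqVlt; apply/orP; left; rewrite -addn1 !(PoszM, PoszD).
by apply/eqP; ring.
Qed.
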